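(* Let $\mathbb{R}$ be the set of real numbers endowed with the usual metric, and let $\mathbb{P}(\mathbb{R})$ be the space of Borel probability measures on $\mathbb{R}$ endowed with the topology of weak convergence. Then $\mathbb{P}(\mathbb{R})$ is not a $\sigma$-compact space.
   Context: The topology of weak convergence on $\mathbb{P}(X)$, for a metric space $X$ with Borel $\sigma$-algebra $\mathcal{B}(X)$, is the coarsest topology on the set $\mathbb{P}(X)$ of probability measures on $\mathcal{B}(X)$ that makes the mapping $\mu \mapsto \int_X v(y)\,\mu(dy)$ continuous for every bounded continuous function $v: X\to\mathbb{R}$. A topological space is $\sigma$-compact if it is a countable union of compact subsets. *)

(* Defs.v *)
From mathcomp Require Import all_boot all_order all_algebra.
From mathcomp Require Import all_classical all_reals all_analysis.

Set Implicit Arguments.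
Unset Strict Implicit.
Unset Printing Implicit Defensive.

Import Order.TTheory GRing.Theory Num.Theory.
Import numFieldNormedType.Exports.

Local Open Scope classical_set_scope.
Local Open Scope ring_scope.

(* The Borel sigma-algebra and the weak topology depend only on the topology of
   the space, so no metric on [X] is recorded. *)
Definition borel (X : ptopologicalType) : measurableType (@open X).-sigma :=
  g_sigma_algebraType (@open X).

Definition bounded_continuous (R : realType) (X : ptopologicalType) : Type :=
  {v : X -> R | continuous v /\ bounded_fun v}.

Definition integral_against (R : realType) (X : ptopologicalType)
    (v : bounded_continuous R X) (mu : probability (borel X) R) : R :=
  \int[mu]_(y in setT) sval v y.

(* The coarsest topology making every [integral_against v] continuous, as the
   supremum of the topologies they individually induce. *)
Definition weak_probability (R : realType) (X : ptopologicalType) :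
    topologicalType :=
  sup_topology (fun v : bounded_continuous R X =>
    Topological.on (initial_topology (@integral_against R X v))).

Definition sigma_compact (T : topologicalType) : Prop :=
  exists K : nat -> set T,
    (forall n, compact (K n)) /\ \bigcup_n K n = [set: T].

(* Main.v *)
Require Import Defs.
From mathcomp Require Import all_boot all_order all_algebra.
From mathcomp Require Import all_classical all_reals all_analysis.
From mathcomp Require Import measurable_realfun.
From HB Require Import structures.

Set Implicit Arguments.
Unset Strict Implicit.
Unset Printing Implicit Defensive.

Import Order.TTheory GRing.Theory Num.Theory.
Import numFieldNormedType.Exports.

(** A weakly compact set K of probability measures on the line is tight: the
    integrals of the cut-offs min(1, max(0, |x| - n)) are weakly continuous,
    decrease with n and tend to 0 at every measure, so by Dini's argument they
    are uniformly small on K.  Given countably many compact sets K_n, let m_n be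
    such that the m_n-th cut-off has integral less than 2^-(n+1) over every
    measure of K_n.  The measure sum_n 2^-(n+1) delta_(m_n + 1) gives that
    cut-off an integral of at least 2^-(n+1), so it lies in no K_n. *)

Local Open Scope classical_set_scope.
Local Open Scope ring_scope.

Lemma continuous_borel_measurable {R : realType} {X : ptopologicalType}
    (f : X -> R) :
  continuous f -> measurable_fun [set: borel X] (f : borel X -> R).
Proof.
move=> /continuousP cf; apply: (measurability _ (RGenOpens.measurableE R)).
move=> _ [_ [a [b ->] <-]]; rewrite setTI.
by apply: sub_sigma_algebra; apply: cf; exact: interval_open.
Qed.

(** The weak topology is a supremum, hence finer than each initial topology: its neighbourhood
    filter at [mu] converges to [mu] in the topology induced by [v] alone. *)
Lemma integral_against_continuous {R : realType} {X : ptopologicalType}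
    (v : bounded_continuous R X) :
  continuous (integral_against v : weak_probability R X -> R).
Proof.
move=> mu; apply: cvg_trans (@initial_continuous _ _ (integral_against v) mu).
apply: cvg_app.
exact: ((cvg_sup (fun w : bounded_continuous R X =>
  Topological.on (initial_topology (@integral_against R X w)))
  (F := nbhs (mu : weak_probability R X)) mu _).1 cvg_id v).
Qed.

Section cutoff.
Context {R : realType}.
Implicit Types (n : nat) (x : R) (mu : probability (borel R) R).

(** A continuous substitute for the indicator of a neighbourhood of infinity: zero on [-n, n], one
    where |x| >= n + 1, linear in |x| in between. *)
Definition cutoff n x : R := Num.min 1 (Num.max 0 (`|x| - n%:R)).

Lemma cutoff_ge0 n x : 0 <= cutoff n x.
Proof. by rewrite /cutoff le_min ler01 le_max lexx. Qed.

Lemma cutoff_le1 n x : cutoff n x <= 1.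
Proof. by rewrite /cutoff ge_min lexx. Qed.

Lemma cutoff_nincr n p x : (n <= p)%N -> cutoff p x <= cutoff n x.
Proof.
move=> np; rewrite /cutoff le_min2// le_max2// lerB//.
by rewrite ler_nat.
Qed.

Lemma cutoff_eq1 n : cutoff n n.+1%:R = 1.
Proof.
rewrite /cutoff normr_nat -natrB// subSnn max_r ?ler01//.
exact: minxx.
Qed.

Lemma cutoff_continuous n : continuous (cutoff n).
Proof.
move=> x; apply: (@continuous_min R R (cst 1)
  (cst 0 \max (fun y => `|y| - n%:R)) x); first exact: cvg_cst.
apply: (@continuous_max R R (cst 0) (fun y => `|y| - n%:R) x); first exact: cvg_cst.
by apply: cvgB; [exact: norm_continuous|exact: cvg_cst].
Qed.

Lemma cutoff_cvg0 x : cutoff ^~ x @ \oo --> (0 : R).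
Proof.
apply: cvg_near_cst; near=> n.
rewrite /cutoff max_l; first by rewrite min_r.
rewrite subr_le0; near: n; exact: nbhs_infty_ger.
Unshelve. all: by end_near. Qed.

Lemma cutoff_bounded n : bounded_fun (cutoff n).
Proof.
exists 1; split; first exact: num_real.
move=> M M1 x _ /=; rewrite ger0_norm ?cutoff_ge0//.
exact: le_trans (cutoff_le1 n x) (ltW M1).
Qed.

Definition bc_cutoff n : bounded_continuous R R :=
  exist _ (cutoff n) (conj (@cutoff_continuous n) (@cutoff_bounded n)).

Lemma integrable_cutoff mu n :
  mu.-integrable [set: borel R] (EFin \o (cutoff n : borel R -> R)).
Proof.
apply: measurable_bounded_integrable => //.
- by rewrite (le_lt_trans (probability_le1 mu _)) ?ltry.
- by apply: continuous_borel_measurable; exact: cutoff_continuous.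
- exact: cutoff_bounded.
Qed.

Lemma integral_cutoff_nincr mu n p : (n <= p)%N ->
  integral_against (bc_cutoff p) mu <= integral_against (bc_cutoff n) mu.
Proof.
move=> np; apply: le_Rintegral => //; try exact: integrable_cutoff.
by move=> x _; exact: cutoff_nincr.
Qed.

Lemma integral_cutoff_cvg0 mu :
  integral_against (bc_cutoff n) mu @[n --> \oo] --> (0 : R).
Proof.
apply: fine_cvg.
(* The limit 0 is rewritten as the integral of the zero function, the pointwise limit of the
   cut-offs, to match dominated convergence with bound 1. *)
rewrite -[X in _ --> X]/(0%E) -(integral0 mu [set: borel R]).
apply: (@dominated_cvg _ _ _ _ _ _ _ _ (EFin \o cst 1)) => //.
- by move=> n; apply: measurable_int (integrable_cutoff mu n).
- by move=> x _; apply: cvg_EFin; [exact: nearW|exact: cutoff_cvg0].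
- exact: finite_measure_integrable_cst.
- by move=> n x _; rewrite lee_fin ger0_norm ?cutoff_ge0// cutoff_le1.
Qed.

Lemma compact_tight (K : set (weak_probability R R)) (e : R) : compact K ->
  0 < e ->
  exists n, forall mu, K mu -> integral_against (bc_cutoff n) mu < e.
Proof.
move=> /compact_near_coveringP cK e0.
(* Near-covering form of compactness: a bound valid for all measures near each point of [K] and all
   large indices holds on the whole of [K] from some index [N] on. *)
have /(_ _)[|N _ KN] := cK nat \oo (fun n mu =>
  integral_against (bc_cutoff n) mu < e) _; last first.
  by exists N => mu Kmu; exact: (KN N (leqnn N) mu Kmu).
move=> mu Kmu.
have [n _ /(_ _ (leqnn n)) mun] : \forall n \near \oo,
    integral_against (bc_cutoff n) mu < e.
  exact: cvgr_lt (integral_cutoff_cvg0 mu) e e0.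
(* Weak continuity makes the bound at the fixed index [n] an open condition on [nu]; monotonicity in
   the index carries it to every [p] beyond [n]. *)
exists ([set nu | integral_against (bc_cutoff n) nu < e],
        [set p | (n <= p)%N]) => /=.
  split; last by exists n.
  exact (cvgr_lt _ (@integral_against_continuous _ _ (bc_cutoff n) mu)
    _ mun).
by move=> [nu p] [/= nue np]; exact: le_lt_trans (integral_cutoff_nincr nu np) nue.
Qed.

(** A Markov-type bound: the indicator of [A] lies below the cut-off. *)
Lemma measure_le_integral_cutoff mu n (A : set (borel R)) : measurable A ->
  (forall x, A x -> cutoff n x = 1) ->
  (mu A <= (integral_against (bc_cutoff n) mu)%:E)%E.
Proof.
move=> mA A1; rewrite /integral_against /Rintegral fineK; last first.
  exact: integrable_fin_num (integrable_cutoff mu n).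
rewrite -{1}(setIT A) -integral_indic//.
apply: ge0_le_integral => //.
- by apply/measurable_EFinP; exact: measurable_indic.
- exact: measurable_int (integrable_cutoff mu n).
- move=> x _; rewrite lee_fin indicE /=; have [|_] := boolP (x \in A).
    by rewrite inE => /A1 /= ->.
  exact: cutoff_ge0.
Qed.

End cutoff.

Section dirac_series.
Context {d} {T : measurableType d} {R : realType} (x : nat -> T).
Local Open Scope ereal_scope.

Let half_ge0 n : (0 <= (2 ^ n.+1)%:R^-1 :> R)%R.
Proof. by rewrite invr_ge0. Qed.

Definition dirac_series : set T -> \bar R :=
  mseries (fun n => mscale (NngNum (half_ge0 n)) (dirac (x n))) 0.

HB.instance Definition _ := Measure.on dirac_series.

Let dirac_series_setT : dirac_series setT = 1.
Proof.
rewrite /dirac_series /mseries.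
(* The weights start at 1/2, so the geometric series sums to exactly 1. *)
have := @cvg_geometric_eseries_half R 1 0; rewrite expr0 divr1.
move=> /(cvg_lim (@ereal_hausdorff R)) <-; apply: congr_lim.
apply/funext => n; apply: eq_bigr => k _.
rewrite -[LHS]/((2 ^ k.+1)%:R^-1%:E * \d_(x k) setT).
by rewrite diracT mule1 addn1 div1r.
Qed.

HB.instance Definition _ :=
  Measure_isProbability.Build _ _ _ dirac_series dirac_series_setT.

Lemma dirac_series_ge n (A : set T) : A (x n) ->
  ((2 ^ n.+1)%:R^-1)%:E <= dirac_series A.
Proof.
move=> Axn; rewrite /dirac_series /mseries.
(* The partial sum of length [n.+1] is the shortest one containing the term of index [n], which
   becomes its last summand. *)
apply: le_trans (nneseries_lim_ge n.+1 _); last by move=> k _ _; exact: measure_ge0.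
rewrite big_nat_recr//= [X in _ + X](_ : _ = ((2 ^ n.+1)%:R^-1)%:E).
  by rewrite leeDr// sume_ge0.
rewrite -[LHS]/((2 ^ n.+1)%:R^-1%:E * \d_(x n) A).
by rewrite diracE mem_set// mule1.
Qed.

End dirac_series.

Theorem proposition3 (R : realType) : ~ sigma_compact (weak_probability R R).
Proof.
move=> [K [cK KT]].
have /choice[m Km] n : exists m, forall mu, K n mu ->
    integral_against (bc_cutoff m) mu < (2 ^ n.+1)%:R^-1.
  by apply: compact_tight => //; rewrite invr_gt0 ltr0n expn_gt0.
pose mu : probability (borel R) R :=
  dirac_series (fun n => (m n).+1%:R : borel R).
have [n _ Kmu] : (\bigcup_n K n) mu by rewrite KT.
have := Km n mu Kmu; apply/negP; rewrite -leNgt -lee_fin.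
(* [A] contains the atom m_n + 1, so [mu A] is at least 2^-(n+1), while the integral of the cut-off
   dominates [mu A]. *)
pose A : set (borel R) := cutoff (m n) @^-1` [set 1].
have mA : measurable A.
  rewrite -[A]setTI; apply: continuous_borel_measurable => //.
  exact: cutoff_continuous.
apply: le_trans (measure_le_integral_cutoff mu mA _) => //.
by apply: dirac_series_ge; exact: cutoff_eq1.
Qed.
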